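(* Let $A \in \mathbb{R}^{n\times n}$ be a nonnegative irreducible matrix with Perron root (spectral radius) $r(A)$, and let $u, v \in \mathbb{R}^n$ be its (entrywise positive) left and right Perron vectors, $u^\top A = r(A)\,u^\top$ and $A v = r(A)\, v$, normalized so that $u^\top v = 1$. Then $$ r(A) = \sup_{x > 0}\ \inf_{y > 0}\ \frac{x^\top D_y A D_y^{-1} x}{x^\top x}, $$ where $x, y$ range over vectors in $\mathbb{R}^n$ with all entries positive. Moreover, the sup and inf are attained at the positive vectors $\hat{x}, \hat{y}$ determined by $\hat{x}^\top D_{\hat{y}} = u^\top$ and $D_{\hat{y}}^{-1}\hat{x} = v$ (i.e. $\hat{x}_i\hat{y}_i = u_i$ and $\hat{x}_i/\hat{y}_i = v_i$ for all $i$), namely $$\hat{x}_i = \sqrt{u_i v_i}, \qquad \hat{y}_i = \sqrt{u_i / v_i}, \qquad i = 1,\dots,n.$$ That is, the supremum over $x>0$ of $\inf_{y>0} \frac{x^\top D_y A D_y^{-1} x}{x^\top x}$ is attained at $x = \hat{x}$, and for $x = \hat{x}$ the infimum over $y>0$ is attained at $y = \hat{y}$; and $$\frac{\hat{x}^\top D_{\hat{y}} A D_{\hat{y}}^{-1}\hat{x}}{\hat{x}^\top \hat{x}} = \frac{u^\top A v}{u^\top v} = u^\top A v = r(A)\, u^\top v = r(A).$$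
   Context: For a square matrix $A$, $r(A) = \max\{|\lambda| : \det(A - \lambda I) = 0\}$ is its spectral radius; for a nonnegative irreducible matrix it is an eigenvalue, called the Perron root. The left and right Perron vectors of a nonnegative irreducible matrix are its entrywise positive left and right eigenvectors associated with the Perron root. For a vector $y \in \mathbb{R}^n$, $D_y$ denotes the $n\times n$ diagonal matrix with diagonal entries $y_1,\dots,y_n$. The notation $x > 0$ for a vector means that every entry is strictly positive. *)

(* Defs.v *)
From HB Require Import structures.
From mathcomp Require Import all_boot all_order all_fingroup all_algebra.
From mathcomp Require Import all_classical all_reals all_analysis.
From mathcomp Require Import complex.
Set Implicit Arguments.
Unset Strict Implicit.
Unset Printing Implicit Defensive.
Import Order.TTheory GRing.Theory Num.Theory.
Import numFieldNormedType.Exports.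
Local Open Scope classical_set_scope.
Local Open Scope ring_scope.

(* The eigenvalues range over the complex numbers R[i]. For 0 < n the set below
   is finite and nonempty, so its supremum is the maximum modulus. *)
Definition spectral_radius (R : realType) (n : nat) (A : 'M[R]_n) : R :=
  sup [set Normc.normc l | l in
        [set l : R[i] | \det (map_mx (real_complex R) A - l%:M) = 0]].

(* Some simultaneous permutation of rows and columns has a zero lower-left
   block of size (n - k) x k with 0 < k < n. Every 1 x 1 matrix, including the
   zero one, is thus irreducible. *)
Definition reducible_mx (R : realType) (n : nat) (A : 'M[R]_n) : Prop :=
  exists (s : 'S_n) (k : nat), (0 < k < n)%N /\
    forall i j : 'I_n, (k <= i)%N -> (j < k)%N ->
      row_perm s (col_perm s A) i j = 0.

Definition irreducible_mx (R : realType) (n : nat) (A : 'M[R]_n) : Prop :=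
  ~ reducible_mx A.

Definition nonneg_mx (R : realType) (n : nat) (A : 'M[R]_n) : Prop :=
  forall i j, 0 <= A i j.

Definition pos_vec (R : realType) (n : nat) (x : 'cV[R]_n) : Prop :=
  forall i, 0 < x i 0.

Definition diag_of (R : realType) (n : nat) (y : 'cV[R]_n) : 'M[R]_n := diag_mx y^T.

(* The 1 x 1 matrices x^T D_y A D_y^-1 x and x^T x are read as scalars through
   their unique entry. *)
Definition scaled_rayleigh (R : realType) (n : nat) (A : 'M[R]_n)
    (x y : 'cV[R]_n) : R :=
  (x^T *m diag_of y *m A *m invmx (diag_of y) *m x) 0 0 / (x^T *m x) 0 0.

(* Infima and suprema are taken in the extended reals, where they always exist,
   so that no default value for unbounded sets is involved. *)
Definition inf_rayleigh (R : realType) (n : nat) (A : 'M[R]_n) (x : 'cV[R]_n) :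
    \bar R :=
  ereal_inf [set (scaled_rayleigh A x y)%:E | y in [set y : 'cV[R]_n | pos_vec y]].

(* Main.v *)
Require Import Defs.
From HB Require Import structures.
From mathcomp Require Import all_boot all_order all_fingroup all_algebra.
From mathcomp Require Import all_classical all_reals all_analysis.
From mathcomp Require Import complex.
Import Order.TTheory GRing.Theory Num.Theory.
Import numFieldNormedType.Exports.
Local Open Scope classical_set_scope.
Local Open Scope ring_scope.

(** The form x^T D_y A D_y^-1 x is the bilinear form a^T A b taken at the
    entrywise product a = x y and the entrywise quotient b = x / y, subject only
    to a_i b_i = x_i ^ 2.

    Upper bound: for any x > 0 the choice y = x / v gives b = v, and then
    A v = r v and a_i v_i = x_i ^ 2 make the quotient exactly r.  Hence every
    inner infimum is at most r ([scaled_rayleigh_right_eigen]).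

    Lower bound: at x = xhat write y_i = yhat_i w_i.  The quotient becomes
    sum_ij u_i A_ij v_j (w_i / w_j).  The weights u_i A_ij v_j are nonnegative
    and balanced: the i-th row sum and the i-th column sum are both r u_i v_i.
    From w_i / w_j >= 1 + ln w_i - ln w_j, the logarithms cancel after
    summation, and the total weight u^T A v = r remains
    ([balanced_bilinear_ge]).  This bound is reached at w = 1, that is at
    y = yhat, so the inner infimum at xhat is r. *)

Lemma invmx_diag_of (R : realType) (n : nat) (y : 'cV[R]_n) :
  pos_vec y -> invmx (diag_of y) = diag_mx (\row_i (y i 0)^-1).
Proof.
move=> y_gt0; set E := diag_mx _.
have DE : diag_of y *m E = 1%:M.
  rewrite /diag_of /E mulmx_diag -diag_const_mx; congr diag_mx.
  by apply/rowP => i; rewrite !mxE mulfV // gt_eqF.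
have Du := (mulmx1_unit DE).1.
by rewrite -[RHS](mulKmx Du) DE mulmx1.
Qed.

Lemma mul_tr_diag_of (R : realType) (n : nat) (x y : 'cV[R]_n) :
  x^T *m diag_of y = (\col_i (x i 0 * y i 0))^T.
Proof. by apply/rowP => i; rewrite /diag_of mul_mx_diag !mxE. Qed.

Lemma mul_invmx_diag_of (R : realType) (n : nat) (x y : 'cV[R]_n) :
  pos_vec y -> invmx (diag_of y) *m x = \col_i (x i 0 / y i 0).
Proof.
move=> y_gt0; rewrite invmx_diag_of //.
by apply/colP => i; rewrite mul_diag_mx !mxE mulrC.
Qed.

Lemma dotE (R : realType) (n : nat) (a b : 'cV[R]_n) :
  (a^T *m b) 0 0 = \sum_i a i 0 * b i 0.
Proof. by rewrite !mxE; apply: eq_bigr => i _; rewrite !mxE. Qed.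

Lemma bilinearE (R : realType) (n : nat) (A : 'M[R]_n) (a b : 'cV[R]_n) :
  (a^T *m A *m b) 0 0 = \sum_i \sum_j a i 0 * A i j * b j 0.
Proof.
rewrite -mulmxA dotE; apply: eq_bigr => i _.
by rewrite mxE big_distrr /=; apply: eq_bigr => j _; rewrite mulrA.
Qed.

Lemma scaled_rayleighE (R : realType) (n : nat) (A : 'M[R]_n)
    (x y : 'cV[R]_n) : pos_vec y ->
  scaled_rayleigh A x y =
    ((\col_i (x i 0 * y i 0))^T *m A *m \col_i (x i 0 / y i 0)) 0 0
      / (x^T *m x) 0 0.
Proof.
move=> y_gt0; rewrite /scaled_rayleigh -(mulmxA _ _ x).
by rewrite mul_invmx_diag_of // mul_tr_diag_of.
Qed.

(** The scaling y = x / v turns x into the eigenvector: D_y^-1 x = v, while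
    D_y v = x brings the numerator back to r x^T x. *)
Lemma scaled_rayleigh_right_eigen (R : realType) (n : nat) (A : 'M[R]_n)
    (r : R) (v x : 'cV[R]_n) :
  pos_vec v -> pos_vec x -> A *m v = r *: v -> (x^T *m x) 0 0 != 0 ->
  scaled_rayleigh A x (\col_i (x i 0 / v i 0)) = r.
Proof.
move=> v_gt0 x_gt0 Av xx_neq0.
have y_gt0 : pos_vec (\col_i (x i 0 / v i 0)).
  by move=> i; rewrite mxE divr_gt0.
rewrite /scaled_rayleigh -(mulmxA _ _ x) mul_invmx_diag_of //.
have -> : \col_i (x i 0 / (\col_k (x k 0 / v k 0)) i 0) = v.
  by apply/colP => i; rewrite !mxE invf_div mulrCA mulfV ?mulr1 // gt_eqF.
rewrite -mulmxA Av -scalemxAr mul_tr_diag_of [X in X / _]mxE.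
suff -> : ((\col_i (x i 0 * (\col_k (x k 0 / v k 0)) i 0))^T *m v) 0 0
    = (x^T *m x) 0 0 by rewrite mulfK.
by rewrite !dotE; apply: eq_bigr => i _; rewrite !mxE -mulrA divfK // gt_eqF.
Qed.

(** The vectors a and b serve only to force n > 0: in dimension zero every dot
    product is an empty sum. *)
Lemma dot_gt0 (R : realType) (n : nat) (a b x : 'cV[R]_n) :
  (a^T *m b) 0 0 != 0 -> pos_vec x -> 0 < (x^T *m x) 0 0.
Proof.
case: n a b x => [|n] a b x; first by rewrite dotE big_ord0 eqxx.
move=> _ x_gt0; rewrite dotE big_ord_recl ltr_pwDl ?mulr_gt0 //.
by apply: sumr_ge0 => i _; rewrite mulr_ge0 // ltW.
Qed.

Lemma ratio_ge_ln (R : realType) (a b : R) :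
  0 < a -> 0 < b -> 1 + (ln a - ln b) <= a / b.
Proof.
by move=> a_gt0 b_gt0; rewrite -ln_div ?posrE // (le_trans (expR_ge1Dx _)) //
  lnK // posrE divr_gt0.
Qed.

(** The weights u_i A_ij v_j have i-th row sum and i-th column sum both equal to
    r u_i v_i, so that sum_ij u_i A_ij v_j (ln w_i - ln w_j) = 0; the rest is
    the tangent bound [ratio_ge_ln]. *)
Lemma balanced_bilinear_ge (R : realType) (n : nat) (A : 'M[R]_n) (r : R)
    (u v w : 'cV[R]_n) :
  nonneg_mx A -> pos_vec u -> pos_vec v -> pos_vec w ->
  u^T *m A = r *: u^T -> A *m v = r *: v ->
  (u^T *m A *m v) 0 0 <=
    ((\col_i (u i 0 * w i 0))^T *m A *m \col_i (v i 0 / w i 0)) 0 0.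
Proof.
move=> A_ge0 u_gt0 v_gt0 w_gt0 uA Av; rewrite !bilinearE.
pose B i j := u i 0 * A i j * v j 0.
have rowB i : \sum_j B i j = r * (u i 0 * v i 0).
  have /colP/(_ i) := Av; rewrite !mxE => Avi.
  rewrite /B mulrCA -Avi big_distrr /=.
  by apply: eq_bigr => j _; rewrite mulrA.
have colB j : \sum_i B i j = r * (u j 0 * v j 0).
  have /rowP/(_ j) := uA; rewrite !mxE => uAj.
  rewrite /B mulrA -uAj big_distrl /=.
  by apply: eq_bigr => i _; rewrite !mxE.
have log_cancel : \sum_i \sum_j B i j * (ln (w i 0) - ln (w j 0)) = 0.
  under eq_bigr => i _ do under eq_bigr => j _ do rewrite mulrBr.
  under eq_bigr => i _ do rewrite sumrB -big_distrl rowB.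
  rewrite sumrB [X in _ - X]exchange_big /=; apply/eqP; rewrite subr_eq0.
  by apply/eqP; apply: eq_bigr => j _; rewrite -big_distrl colB.
rewrite -[leLHS]addr0 -[X in _ + X <= _]log_cancel -big_split /=; apply: ler_sum => i _.
rewrite -big_split /=; apply: ler_sum => j _; rewrite !mxE.
have -> : u i 0 * w i 0 * A i j * (v j 0 / w j 0) = B i j * (w i 0 / w j 0).
  by rewrite (mulrAC (u i 0)) mulrACA.
rewrite -[u i 0 * _ * _]mulr1 -mulrDr ler_wpM2l ?ratio_ge_ln //.
by rewrite /B !mulr_ge0 // ltW.
Qed.

Theorem theorem1 (R : realType) (n : nat) (A : 'M[R]_n) (u v : 'cV[R]_n)
    (A_ge0 : nonneg_mx A) (A_irr : irreducible_mx A)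
    (u_gt0 : pos_vec u) (v_gt0 : pos_vec v)
    (u_left : u^T *m A = spectral_radius A *: u^T)
    (v_right : A *m v = spectral_radius A *: v)
    (uv1 : (u^T *m v) 0 0 = 1) :
  let xhat : 'cV[R]_n := \col_i Num.sqrt (u i 0 * v i 0) in
  let yhat : 'cV[R]_n := \col_i Num.sqrt (u i 0 / v i 0) in
  (* the sup-inf formula *)
  (spectral_radius A)%:E =
    ereal_sup [set inf_rayleigh A x | x in [set x : 'cV[R]_n | pos_vec x]] /\
  (* xhat and yhat are the positive vectors determined by the two equations *)
  (pos_vec xhat /\ pos_vec yhat) /\
  (forall x y : 'cV[R]_n, pos_vec x -> pos_vec y ->
     (x^T *m diag_of y = u^T /\ invmx (diag_of y) *m x = v) <-> (x = xhat /\ y = yhat)) /\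
  (* the supremum is attained at xhat, and then the infimum at yhat *)
  ereal_sup [set inf_rayleigh A x | x in [set x : 'cV[R]_n | pos_vec x]] =
    inf_rayleigh A xhat /\
  inf_rayleigh A xhat = (scaled_rayleigh A xhat yhat)%:E /\
  (* the value at (xhat, yhat) *)
  scaled_rayleigh A xhat yhat = (u^T *m A *m v) 0 0 / (u^T *m v) 0 0 /\
  (u^T *m A *m v) 0 0 / (u^T *m v) 0 0 = (u^T *m A *m v) 0 0 /\
  (u^T *m A *m v) 0 0 = spectral_radius A * (u^T *m v) 0 0 /\
  spectral_radius A * (u^T *m v) 0 0 = spectral_radius A.
Proof.
set r := spectral_radius A in u_left v_right *.
move=> xhat yhat.
have uv_neq0 : (u^T *m v) 0 0 != 0 by rewrite uv1 oner_eq0.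
have xhat_gt0 : pos_vec xhat by move=> i; rewrite mxE sqrtr_gt0 mulr_gt0.
have yhat_gt0 : pos_vec yhat by move=> i; rewrite mxE sqrtr_gt0 divr_gt0.
have xhat_sqr i : xhat i 0 * xhat i 0 = u i 0 * v i 0.
  by rewrite mxE -expr2 sqr_sqrtr // mulr_ge0 // ltW.
have hat_mul i : xhat i 0 * yhat i 0 = u i 0.
  rewrite !mxE -sqrtrM ?mulr_ge0 ?ltW // mulrACA mulfV ?mulr1 ?gt_eqF //.
  by rewrite -expr2 sqrtr_sqr ger0_norm // ltW.
have hat_div i : xhat i 0 / yhat i 0 = v i 0.
  apply: (mulfI (lt0r_neq0 (u_gt0 i))); rewrite -{1}hat_mul mulrACA.
  by rewrite mulfV ?mulr1 ?xhat_sqr // gt_eqF.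
have xhat_xhat : (xhat^T *m xhat) 0 0 = 1.
  by rewrite -uv1 !dotE; apply: eq_bigr => i _; rewrite xhat_sqr.
have uAv : (u^T *m A *m v) 0 0 = r * (u^T *m v) 0 0.
  by rewrite u_left -scalemxAl mxE.
have hat_val : scaled_rayleigh A xhat yhat = r.
  rewrite scaled_rayleighE // xhat_xhat divr1 -[RHS]mulr1 -uv1 -uAv.
  by congr ((_^T *m _ *m _) 0 0); apply/colP => i; rewrite !mxE;
    [rewrite -[RHS]hat_mul !mxE | rewrite -[RHS]hat_div !mxE].
have inf_le x : pos_vec x -> (inf_rayleigh A x <= r%:E)%E.
  move=> x_gt0; apply: ereal_inf_lbound.
  exists (\col_i (x i 0 / v i 0)); first by move=> i; rewrite mxE divr_gt0.
  congr (_%:E); apply: scaled_rayleigh_right_eigen => //.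
  by rewrite gt_eqF // (dot_gt0 _ _ _ _ _ uv_neq0).
have inf_hat : inf_rayleigh A xhat = r%:E.
  apply/eqP; rewrite eq_le inf_le //=; apply: le_ereal_inf_tmp => _ [y y_gt0 <-].
  rewrite lee_fin scaled_rayleighE // xhat_xhat divr1 -[r]mulr1 -uv1 -uAv.
  pose w : 'cV[R]_n := \col_i (y i 0 / yhat i 0).
  have w_gt0 : pos_vec w by move=> i; rewrite mxE divr_gt0.
  apply: (le_trans (balanced_bilinear_ge _ _ _ _ _ _ _ A_ge0 u_gt0 v_gt0 w_gt0 u_left v_right)).
  have -> : \col_i (xhat i 0 * y i 0) = \col_i (u i 0 * w i 0).
    apply/colP => i; rewrite [LHS]mxE [RHS]mxE [w i 0]mxE -hat_mul.
    by rewrite mulrACA mulrA mulfK // gt_eqF.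
  suff -> : \col_i (xhat i 0 / y i 0) = \col_i (v i 0 / w i 0) by [].
  apply/colP => i; rewrite [LHS]mxE [RHS]mxE [w i 0]mxE -hat_div.
  by rewrite invf_div mulrA divfK // gt_eqF.
have sup_r :
    ereal_sup [set inf_rayleigh A x | x in [set x : 'cV[R]_n | pos_vec x]]
      = r%:E.
  apply/eqP; rewrite eq_le; apply/andP; split.
    by apply: ge_ereal_sup => _ [x x_gt0 <-]; exact: inf_le.
  by rewrite -inf_hat; apply: ereal_sup_ubound; exists xhat.
split; first by rewrite sup_r.
split; first by [].
split.
  move=> x y x_gt0 y_gt0; rewrite mul_tr_diag_of mul_invmx_diag_of //; split.
    case=> /trmx_inj/colP xy /colP xdy.
    have xyE i : x i 0 * y i 0 = u i 0 by rewrite -xy mxE.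
    have xdyE i : x i 0 / y i 0 = v i 0 by rewrite -xdy mxE.
    (* The product of the two equations is x_i ^ 2 = u_i v_i; y then follows
       from x_i y_i = u_i. *)
    have xE : x = xhat.
      apply/colP => i; rewrite [RHS]mxE -xyE -xdyE mulrACA mulfV ?gt_eqF //.
      by rewrite mulr1 -expr2 sqrtr_sqr gtr0_norm.
    split=> //; apply/colP => i; apply: (mulfI (lt0r_neq0 (x_gt0 i))).
    by rewrite xyE xE hat_mul.
  by move=> [-> ->]; split; [congr trmx|]; apply/colP => i;
    rewrite [LHS]mxE ?hat_mul ?hat_div.
by rewrite sup_r inf_hat hat_val uAv uv1 !mulr1 divr1.
Qed.
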